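(* Let $0\le\rho<1$, let $X$ and $Y$ be real Banach spaces such that $\beta(Y)\le\rho$ and $X$ is uniformly non-square with $\alpha(X)>\alpha_0>0$, and let $$\varepsilon_0=\min\left\{\frac{2}{1-\frac13\alpha_0}\cdot\frac{1-\rho}{1+\rho},\ \frac12\cdot\frac{1+\rho}{1-\rho}\left(1-\frac13\alpha_0\right)\right\}.$$ Then for every $0<\varepsilon<\varepsilon_0$ $$\Phi^S(X,Y,\varepsilon)\le\sqrt{2\varepsilon\left(1-\frac13\alpha_0\right)}\,\sqrt{\frac{1+\rho}{1-\rho}}.$$
   Context: All Banach spaces are real. $B_X$, $S_X$ denote the closed unit ball and unit sphere of $X$; $L(X,Y)$ is the space of bounded linear operators $X\to Y$ with the operator norm; $X^*=L(X,\mathbb{R})$. Property $\beta$: $Y$ has property $\beta$ with parameter $\rho$, $0\le\rho<1$ (written $\beta(Y)\le\rho$), if there are two sets $\{y_\alpha:\alpha\in\Lambda\}\subset S_Y$ and $\{y^*_\alpha:\alpha\in\Lambda\}\subset S_{Y^*}$ such that (i) $y^*_\alpha(y_\alpha)=1$ for all $\alpha$; (ii) $|y^*_\alpha(y_\gamma)|\le\rho$ whenever $\alpha\ne\gamma$; (iii) $\|y\|=\sup\{|y^*_\alpha(y)|:\alpha\in\Lambda\}$ for all $y\in Y$. Parameter of uniform non-squareness: $\alpha(X):=2-\sup_{x,y\in B_X}\left\{\frac12(\|x+y\|+\|x-y\|)\right\}$; $X$ is uniformly non-square if $\alpha(X)>0$. Spherical Bishop-Phelps-Bollobás modulus: for $\varepsilon\in(0,1)$,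 $\Phi^S(X,Y,\varepsilon)$ is the infimum of those $\delta>0$ such that for every $(x,T)\in S_X\times S_{L(X,Y)}$ with $\|T(x)\|>1-\varepsilon$ there is $(z,F)\in S_X\times S_{L(X,Y)}$ with $\|F(z)\|=1$, $\|x-z\|<\delta$ and $\|T-F\|<\delta$. *)

(* Defs.v *)
From HB Require Import structures.
From mathcomp Require Import all_boot all_order all_algebra.
From mathcomp Require Import all_classical all_reals all_analysis.

Set Implicit Arguments.
Unset Strict Implicit.
Unset Printing Implicit Defensive.

Import Order.TTheory GRing.Theory Num.Theory.
Import numFieldNormedType.Exports.

Local Open Scope classical_set_scope.
Local Open Scope ring_scope.

Definition unit_ball (R : realType) (X : normedModType R) : set X :=
  [set x | `|x| <= 1].

Definition unit_sphere (R : realType) (X : normedModType R) : set X :=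
  [set x | `|x| = 1].

(* Only meaningful when T is bounded on the unit ball: the supremum of an
   unbounded set is 0 by convention. *)
Definition opnorm (R : realType) (X Y : normedModType R) (T : X -> Y) : R :=
  sup [set `|T x| | x in @unit_ball R X].

Definition bounded_operator (R : realType) (X Y : normedModType R)
    (T : {linear X -> Y}) : Prop :=
  [bounded T x | x in @unit_ball R X].

Definition operator_sphere (R : realType) (X Y : normedModType R) :
    set {linear X -> Y} :=
  [set T | bounded_operator T /\ opnorm T = 1].

(* beta(Y) <= rho.  The dual sphere is [operator_sphere Y R^o]; an empty index
   type is possible only for Y = 0, as the supremum of the empty set is 0. *)
Definition property_beta (R : realType) (Y : normedModType R) (rho : R) :
    Prop :=
  0 <= rho < 1 /\
  exists (Lambda : Type) (y : Lambda -> Y) (ys : Lambda -> {linear Y -> R^o}),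
    [/\ forall a, unit_sphere (y a) /\ operator_sphere (ys a),
        forall a, ys a (y a) = 1,
        forall a c, a <> c -> `|ys a (y c)| <= rho
      & forall v : Y, `|v| = sup [set `|ys a v| | a in [set: Lambda]]].

(* alpha(X), the parameter of uniform non-squareness. *)
Definition nonsquareness (R : realType) (X : normedModType R) : R :=
  2 - sup [set 2^-1 * (`|p.1 + p.2| + `|p.1 - p.2|) |
           p in @unit_ball R X `*` @unit_ball R X].

Definition uniformly_nonsquare (R : realType) (X : normedModType R) : Prop :=
  0 < nonsquareness X.

(* The infimum is taken in the extended reals, where the infimum of the empty
   set is +oo. *)
Definition spherical_BPB_modulus (R : realType) (X Y : normedModType R)
    (eps : R) : \bar R :=
  ereal_inf [set delta%:E | delta in [set delta : R | 0 < delta /\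
    forall (x : X) (T : {linear X -> Y}),
      unit_sphere x -> operator_sphere T -> 1 - eps < `|T x| ->
      exists (z : X) (F : {linear X -> Y}),
        [/\ unit_sphere z, operator_sphere F, `|F z| = 1,
            `|x - z| < delta & opnorm (T \- F) < delta]]].

(* Main.v *)
Require Import Defs.
From HB Require Import structures.
From mathcomp Require Import all_boot all_order all_algebra.
From mathcomp Require Import all_classical all_reals all_analysis.
From mathcomp Require Import ring lra.

Set Implicit Arguments.
Unset Strict Implicit.
Unset Printing Implicit Defensive.

Import Order.TTheory GRing.Theory Num.Theory.
Import numFieldNormedType.Exports.

Local Open Scope classical_set_scope.
Local Open Scope ring_scope.

(* Pick [b] with [|ys b (T x)| > 1 - eps] and let [f = ys b \o T].  Ekeland's
   principle on the unit ball and Hahn-Banach (Bishop-Phelps) give [v], attaining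
   its norm at some [z] near [x], with [opnorm (f - v) <= k].  Normalising [v]
   to [g] costs up to another [k], but non-squareness, which is self-dual,
   forbids the extreme case and leaves [2 k (1 - alpha0 / 3)].  Then
   [T + ((1 + eta) g - f) (x) y_b], rescaled, attains its norm at [z] for a
   suitable [eta], by property beta.  When the target distance [delta] exceeds
   [2 (1 - alpha0 / 3)], the position of [x] is irrelevant: any norm-attaining
   [F] close to [T] attains its norm at both [z] and [- z], and one of them is
   close to [x] by non-squareness. *)

(** * Normalising a perturbed vector in a plane *)

(** The intended [n s t] is the dual norm of [s f + t v]. Coordinates allow [f] and [v] to be
    linearly dependent, so [n] is treated as a seminorm. *)
Lemma seminorm_normalization (R : realFieldType) (n : R -> R -> R) (a k : R) :
  (forall x y x' y', n (x + x') (y + y') <= n x y + n x' y') ->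
  (forall t x y, n (t * x) (t * y) = `|t| * n x y) ->
  (forall x y x' y', n x y <= 1 -> n x' y' <= 1 ->
     n (x + x') (y + y') + n (x - x') (y - y') <= 4 - 2 * a) ->
  0 <= a <= 1 -> 0 < k <= 2^-1 -> n 1 0 = 1 -> n 1 (-1) <= k ->
  n 1 (- (n 0 1)^-1) <= 2 * k * (1 - 3^-1 * a).
Proof.
move=> nD nZ nsq /andP[a0 a1] /andP[k0 k2] n10 n1N; set l := n 0 1.
have lk : l <= 1 + k.
  have := nD 1 0 (-1) 1; rewrite subrr add0r -/l n10 => h.
  have := nZ (-1) 1 (-1); rewrite mulr1 mulrNN mulr1 normrN1 mul1r => e.
  lra.
have kl : 1 - k <= l.
  by have := nD 0 1 1 (-1); rewrite subrr add0r -/l n10 => h; lra.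
have l0 : 0 < l by lra.
have ln : l != 0 by rewrite gt_eqF.
have kn : k != 0 by rewrite gt_eqF.
have np t x y : 0 <= t -> n (t * x) (t * y) = t * n x y.
  by move=> t0; rewrite nZ ger0_norm.
have n0t t : 0 <= t -> n 0 t = t * l.
  by move=> t0; rewrite -(np t 0 1 t0) mulr0 mulr1.
have ng : n 0 l^-1 <= 1 by rewrite n0t ?invr_ge0 ?(ltW l0)// mulVf.
have nw : n k^-1 (- k^-1) <= 1.
  have := np k^-1 1 (-1); rewrite mulr1 mulrN1 => ->; last by rewrite invr_ge0 ltW.
  by rewrite ler_pdivrMl// mulr1.
(* [u = (1,0)], [v = (0,1)], [g = v/l], [w = (u-v)/k], [tau = |1-l|/k]; two
   bounds for [|u-g|]: the triangle inequality gives [k(1+tau)], and the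
   lower bound [1+tau] on [|w+g|] or [|u-w|] gives, by non-squareness,
   [k(2 - (1-tau)^2 - 2 a tau)]. *)
have [tau [tau0 tau1 b1 b2]] : exists tau, [/\ 0 <= tau, tau <= 1,
    n 1 (- l^-1) <= k * (1 + tau) &
    n 1 (- l^-1) <= k * (tau * (3 - 2 * a - tau) + (1 - tau))].
  have [l1|l1] := leP l 1.
    exists ((1 - l) / k); split.
    - by rewrite divr_ge0 ?subr_ge0// ltW.
    - by rewrite ler_pdivrMr//; lra.
    - rewrite mulrDr mulr1 [k * (_ / _)]mulrC divfK//.
      have := nD 1 (-1) 0 (1 - l^-1).
      rewrite addr0 addrA [-1 + 1]addrC subrr add0r.
      have := nZ (-1) 0 (l^-1 - 1); rewrite mulr0 mulN1r opprB normrN1 mul1r => ->.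
      rewrite n0t ?subr_ge0 ?invf_ge1// mulrBl mul1r mulVf//.
      by move=> h; lra.
    - set tau := _ / k.
      have tk : tau * k = 1 - l by rewrite /tau divfK.
      have tau0 : 0 <= tau by rewrite divr_ge0 ?subr_ge0// ltW.
      (* Split [u = k (w + g) + (l - k) g]. *)
      have lbd : 1 + tau <= n (k^-1 + 0) (- k^-1 + l^-1).
        have := nD (k * (k^-1 + 0)) (k * (- k^-1 + l^-1))
          ((l - k) * 0) ((l - k) * l^-1).
        rewrite !np ?subr_ge0 ?(ltW k0)//; last by lra.
        have -> : k * (k^-1 + 0) + (l - k) * 0 = 1 by field.
        have -> : k * (- k^-1 + l^-1) + (l - k) * l^-1 = 0.
          by field; apply/andP.
        rewrite n10 => h; rewrite -(ler_pM2l k0).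
        have := ler_wpM2l (_ : 0 <= l - k) ng; rewrite mulr1 subr_ge0 => h'.
        have /h' h2 : k <= l by lra.
        by lra.
      have ubd := nsq _ _ _ _ nw ng.
      (* Split [u - g = k tau (w - g) + k (1 - tau) w]; non-squareness for [w] and [g] bounds the
         first term. *)
      have := nD (k * tau * (k^-1 - 0)) (k * tau * (- k^-1 - l^-1))
          (k * (1 - tau) * k^-1) (k * (1 - tau) * - k^-1).
      have tau1 : tau <= 1 by rewrite ler_pdivrMr//; lra.
      rewrite !np; [|by rewrite mulr_ge0// ?subr_ge0// ltW..].
      have -> : k * tau * (k^-1 - 0) + k * (1 - tau) * k^-1 = 1 by field.
      have -> : k * tau * (- k^-1 - l^-1) + k * (1 - tau) * - k^-1 = - l^-1.
        by rewrite (mulrC k tau) tk /tau; field; apply/andP.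
      move=> /le_trans; apply; rewrite [leRHS]mulrDr (mulrA k tau); apply: lerD.
        by apply: ler_wpM2l; [rewrite mulr_ge0 ?(ltW k0)|lra].
      by rewrite ler_piMr// mulr_ge0 ?subr_ge0// ltW.
  exists ((l - 1) / k); split.
  - by rewrite divr_ge0 ?subr_ge0// ltW.
  - by rewrite ler_pdivrMr//; lra.
  - rewrite mulrDr mulr1 [k * (_ / _)]mulrC divfK//.
    have := nD 1 (-1) 0 (1 - l^-1).
    rewrite addr0 addrA [-1 + 1]addrC subrr add0r.
    rewrite n0t ?subr_ge0 ?invf_le1 ?(ltW l1)// mulrBl mul1r mulVf//.
    by move=> h; lra.
  - set tau := _ / k.
    have tk : tau * k = l - 1 by rewrite /tau divfK.
    have tau0 : 0 <= tau by rewrite divr_ge0 ?subr_ge0// ltW.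
    have tau1 : tau <= 1 by rewrite ler_pdivrMr//; lra.
    have nu : n 1 0 <= 1 by rewrite n10.
    (* Split [v = k (u - w) + (1 - k) u]. *)
    have lbd : 1 + tau <= n (1 - k^-1) (0 - - k^-1).
      have := nD (k * (1 - k^-1)) (k * (0 - - k^-1)) ((1 - k) * 1) ((1 - k) * 0).
      rewrite !np ?subr_ge0 ?(ltW k0)//; last by lra.
      have -> : k * (1 - k^-1) + (1 - k) * 1 = 0 by field.
      have -> : k * (0 - - k^-1) + (1 - k) * 0 = 1 by field.
      rewrite n10 -/l => h; rewrite -(ler_pM2l k0).
      by lra.
    have ubd := nsq _ _ _ _ nu nw.
    (* Split [l (u - g) = k tau (u + w) + k (1 - tau) w]; the factor [l > 1] on the left is dropped
       at the end. *)
    have := nD (k * tau * (1 + k^-1)) (k * tau * (0 + - k^-1))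
        (k * (1 - tau) * k^-1) (k * (1 - tau) * - k^-1).
    rewrite !np; [|by rewrite mulr_ge0// ?subr_ge0// ltW..].
    have -> : k * tau * (1 + k^-1) + k * (1 - tau) * k^-1 = l * 1.
      by rewrite /tau; field.
    have -> : k * tau * (0 + - k^-1) + k * (1 - tau) * - k^-1 = l * (- l^-1).
      by field; apply/andP.
    rewrite (np l) ?(ltW l0)// => h.
    have ge0 : 0 <= n 1 (- l^-1).
      have := nD 1 (- l^-1) (-1 * 1) (-1 * (- l^-1)).
      rewrite nZ normrN1 mul1r mulr1 mulN1r opprK subrr addNr.
      by have := np 0 0 1 (lexx _); rewrite !mul0r => ->; lra.
    apply: le_trans (ler_peMl ge0 (ltW l1)) (le_trans h _).
    rewrite [leRHS]mulrDr (mulrA k tau); apply: lerD.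
      by apply: ler_wpM2l; [rewrite mulr_ge0 ?(ltW k0)|lra].
    by rewrite ler_piMr// mulr_ge0 ?subr_ge0// ltW.
(* Source of the constant 1/3: below it the first bound is at most [4 k / 3], which suffices since
   [a <= 1]; above it [2 a tau] exceeds [2 a / 3]. *)
have [t3|t3] := leP tau 3^-1.
  apply: le_trans b1 _; rewrite -mulrA mulrCA ler_pM2l//; lra.
apply: le_trans b2 _; rewrite -mulrA mulrCA ler_pM2l//.
have := mulr_ge0 a0 (ltW (_ : 0 < tau - 3^-1)); rewrite subr_gt0 => /(_ t3) h.
have := sqr_ge0 (1 - tau); rewrite expr2 => h2; nra.
Qed.

(** * Operator norms *)

(** Stated for bare functions, so that pointwise sums and multiples of operators need no bundled
    linear structure. *)
Definition ball_bounded (R : realType) (X Y : normedModType R) (T : X -> Y) :=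
  exists M : R, forall x, `|x| <= 1 -> `|T x| <= M.

Lemma bounded_operatorP (R : realType) (X Y : normedModType R)
  (T : {linear X -> Y}) : bounded_operator T <-> ball_bounded T.
Proof.
split=> [/pinfty_ex_gt -/(_ 0 (num_real _))[M _ TM]|[M TM]].
  by exists M => x x1; exact: TM.
by exists M; split=> [|r Mr x x1 /=]; rewrite ?num_real// (le_trans (TM _ x1))// ltW.
Qed.

Section opnorm_theory.
Variables (R : realType) (X Y : normedModType R).
Implicit Types (T S : X -> Y) (x : X) (M : R).

Lemma opnorm_ub T x : ball_bounded T -> `|x| <= 1 -> `|T x| <= opnorm T.
Proof.
move=> [M TM] x1; apply: ub_le_sup; last by exists x.
by exists M => _ [y y1 <-]; exact: TM.
Qed.

Lemma opnorm_le T M : (forall x, `|x| <= 1 -> `|T x| <= M) -> opnorm T <= M.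
Proof.
move=> TM; apply: ge_sup; first by exists `|T 0|, 0; rewrite // /unit_ball/= normr0.
by move=> _ [y y1 <-]; exact: TM.
Qed.

Lemma opnorm_ge0 T : ball_bounded T -> 0 <= opnorm T.
Proof.
by move=> bT; apply: le_trans (opnorm_ub bT (_ : `|0| <= 1)); rewrite ?normr0.
Qed.

Lemma opnorm_gt T M : 0 <= M -> M < opnorm T -> exists2 x, `|x| <= 1 & M < `|T x|.
Proof.
move=> M0 /sup_gt[|_ [x x1 <-]]; first by exists `|T 0|, 0; rewrite // /unit_ball/= normr0.
by exists x.
Qed.

Lemma ball_boundedD T S :
  ball_bounded T -> ball_bounded S -> ball_bounded (fun x => T x + S x).
Proof.
move=> [M TM] [N SN]; exists (M + N) => x x1.
by rewrite (le_trans (ler_normD _ _))// lerD ?TM ?SN.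
Qed.

Lemma ball_boundedZ T t : ball_bounded T -> ball_bounded (fun x => t *: T x).
Proof.
by move=> [M TM]; exists (`|t| * M) => x x1; rewrite normrZ ler_wpM2l ?TM.
Qed.

Lemma opnormD T S : ball_bounded T -> ball_bounded S ->
  opnorm (fun x => T x + S x) <= opnorm T + opnorm S.
Proof.
move=> bT bS; apply: opnorm_le => x x1.
by rewrite (le_trans (ler_normD _ _))// lerD ?opnorm_ub.
Qed.

Lemma opnormZ T t : ball_bounded T ->
  opnorm (fun x => t *: T x) = `|t| * opnorm T.
Proof.
move=> bT; apply/eqP; rewrite eq_le; apply/andP; split.
  by apply: opnorm_le => x x1; rewrite normrZ ler_wpM2l ?opnorm_ub.
have [->|t0] := eqVneq t 0.
  by rewrite normr0 mul0r opnorm_ge0//; exact: ball_boundedZ.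
rewrite -ler_pdivlMl ?normr_gt0//; apply: opnorm_le => x x1.
rewrite ler_pdivlMl ?normr_gt0// -normrZ.
exact: (opnorm_ub (ball_boundedZ t bT) x1).
Qed.

Lemma opnorm_linear (T : {linear X -> Y}) x :
  ball_bounded T -> `|T x| <= opnorm T * `|x|.
Proof.
move=> bT; have [->|x0] := eqVneq x 0; first by rewrite linear0 !normr0 mulr0.
rewrite -ler_pdivrMr ?normr_gt0// mulrC -[X in X * _]gtr0_norm ?invr_gt0 ?normr_gt0//.
rewrite -normrZ -linearZ; apply: opnorm_ub => //.
by rewrite normrZ normfV normr_id mulVf ?normr_eq0.
Qed.

Lemma opnorm_sphere_gt (T : {linear X -> Y}) M : ball_bounded T ->
  0 <= M -> M < opnorm T -> exists2 x, `|x| = 1 & M < `|T x|.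
Proof.
move=> bT M0 /opnorm_gt[//|x x1 MTx].
have x0 : 0 < `|x|.
  rewrite normr_gt0; apply: contraTneq MTx => ->.
  by rewrite linear0 normr0 -leNgt.
exists (`|x|^-1 *: x); first by rewrite normrZ normfV normr_id mulVf ?gt_eqF.
rewrite linearZ normrZ normfV normr_id (lt_le_trans MTx)//.
by rewrite ler_peMl// invf_ge1.
Qed.

End opnorm_theory.

(** * Non-squareness of a space and of its dual *)

Lemma nonsquarenessP (R : realType) (X : normedModType R) (x y : X) :
  `|x| <= 1 -> `|y| <= 1 -> `|x + y| + `|x - y| <= 2 * (2 - nonsquareness X).
Proof.
move=> x1 y1; rewrite /nonsquareness subKr -ler_pdivrMl//.
apply: ub_le_sup; last by exists (x, y).
exists 2 => _ [[u v] [/= u1 v1] <-].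
have := ler_normD u v; have := ler_normB u v.
move: u1 v1; rewrite /unit_ball/= => u1 v1.
by move=> h h'; lra.
Qed.

(** Pair [x] with itself. The unit vector excludes the zero space, whose parameter is 2. *)
Lemma nonsquareness_le1 (R : realType) (X : normedModType R) (x : X) :
  `|x| = 1 -> nonsquareness X <= 1.
Proof.
move=> x1; have := @nonsquarenessP _ X x x; rewrite x1 subrr normr0 -mulr2n.
by rewrite normrMn x1 => /(_ (lexx _) (lexx _)); lra.
Qed.

(* Non-squareness passes to the dual because
   [(f + g) x + (f - g) y = f (x + y) + g (x - y)]. *)
Lemma dual_nonsquareness (R : realType) (X : normedModType R)
    (f g : {linear X -> R^o}) : ball_bounded f -> ball_bounded g ->
  opnorm f <= 1 -> opnorm g <= 1 ->
  opnorm (fun x => f x + g x) + opnorm (fun x => f x - g x) <=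
    4 - 2 * nonsquareness X.
Proof.
move=> bf bg f1 g1.
have key (x y : X) : `|x| <= 1 -> `|y| <= 1 ->
    `|f x + g x| + `|f y - g y| <= 4 - 2 * nonsquareness X.
  have pos (u v : X) : `|u| <= 1 -> `|v| <= 1 ->
      (f u + g u) + (f v - g v) <= 4 - 2 * nonsquareness X.
    move=> u1 v1; have := nonsquarenessP u1 v1.
    have : f (u + v) <= `|u + v|.
      rewrite (le_trans (ler_norm _))// (le_trans (opnorm_linear _ bf))//.
      by rewrite ler_piMl.
    have : g (u - v) <= `|u - v|.
      rewrite (le_trans (ler_norm _))// (le_trans (opnorm_linear _ bg))//.
      by rewrite ler_piMl.
    rewrite linearB linearD/= => h1 h2 h3.
    have e : (f u + g u) + (f v - g v) = (f u + f v) + (g u - g v).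
      by rewrite addrACA (addrC (g u)) -[in RHS](addrA (f u)) (addrA (f u)) addrACA.
    by rewrite e; lra.
  move=> x1 y1.
  (* The four sign choices for [x] and [y] turn the signed bound into one on absolute values. *)
  have nx1 : `|- x| <= 1 by rewrite normrN.
  have ny1 : `|- y| <= 1 by rewrite normrN.
  have := pos _ _ x1 y1; have := pos _ _ x1 ny1.
  have := pos _ _ nx1 y1; have := pos _ _ nx1 ny1.
  rewrite !linearN/= => h1 h2 h3 h4.
  by case: (ger0P (f x + g x)) => _; case: (ger0P (f y - g y)) => _; lra.
rewrite -lerBrDr; apply: opnorm_le => x x1; rewrite lerBrDr addrC -lerBrDr.
by apply: opnorm_le => y y1; rewrite lerBrDr addrC; exact: key.
Qed.

(** * Ekeland's variational principle *)

(** A move from [y] to [u] is allowed when [f] gains at least [k] times the distance. Nearly optimal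
    moves converge by completeness, and no profitable move starts at the limit. *)
Lemma ekeland (R : realType) (X : completeNormedModType R) (A : set X)
    (f : X -> R) (k : R) (x : X) :
  closed A -> continuous f -> has_ubound (f @` A) -> 0 < k -> A x ->
  exists z, [/\ A z, k * `|z - x| <= f z - f x &
    forall u, A u -> f u <= f z + k * `|u - z| ].
Proof.
move=> cA cf ubf k0 Ax.
pose S (y : X) := [set u | A u /\ k * `|u - y| <= f u - f y].
have Sxx y : A y -> S y y by move=> Ay; split; rewrite ?subrr ?normr0 ?mulr0.
have Strans y u v : S y u -> S u v -> S y v.
  move=> [Au yu] [Av uv]; split=> //.
  rewrite (le_trans _ (_ : (f v - f u) + (f u - f y) <= _))//; last by lra.
  rewrite (le_trans _ (lerD uv yu))// -mulrDr ler_pM2l//.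
  by rewrite (le_trans _ (ler_normD _ _))// addrA subrK.
have ubS y : has_ubound (f @` S y).
  by case: ubf => M fM; exists M => _ [u [Au _] <-]; apply: fM; exists u.
(* [next y] realises at least half of the gain still available in [S y]. *)
pose next (y : X) : X :=
  get [set u | S y u /\ sup (f @` S y) - f u <= f u - f y].
have nextP y : A y ->
    S y (next y) /\ sup (f @` S y) - f (next y) <= f (next y) - f y.
  move=> Ay.
  apply: (@getPex _ [set u | S y u /\ sup (f @` S y) - f u <= f u - f y]).
  have fyS : (f @` S y) (f y) by exists y => //; exact: Sxx.
  have [ys|ys] := ltP (f y) (sup (f @` S y)); last first.
    exists y; split; first exact: Sxx.
    by rewrite subrr subr_le0.
  have [||_ [u Su <-] us] := @sup_gt _ (f @` S y) ((f y + sup (f @` S y)) / 2).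
  - by exists (f y).
  - by lra.
  by exists u; split=> //; lra.
pose z_ n := iter n next x.
have Az n : A (z_ n).
  by elim: n => [//|n IH]; have [[]] := nextP _ IH.
have Sz n m : (n <= m)%N -> S (z_ n) (z_ m).
  move=> /subnK <-; elim: (m - n)%N => [|p IH]; first exact: Sxx.
  by apply: Strans IH _; have [] := nextP _ (Az (p + n)%N).
have fz_nd : nondecreasing_seq (f \o z_).
  move=> n m nm /=; have [_ h] := Sz _ _ nm; rewrite -subr_ge0; apply: le_trans h.
  by rewrite mulr_ge0// ltW.
have fz_cvg : cvgn (f \o z_).
  apply: nondecreasing_is_cvgn => //.
  by case: ubf => M fM; exists M => _ [n _ <-]; apply: fM; exists (z_ n).
have fz_lim n : f (z_ n) <= limn (f \o z_).
  exact: (nondecreasing_cvgn_le fz_nd fz_cvg).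
have z_cvg : cvgn z_.
  (* The distance from [z_ N] to a later iterate, times [k], is at most the gain of [f], hence at
     most the limit of [f] along the sequence minus [f (z_ N)]. *)
  apply/cauchy_cvgP/cauchy_exP => _/posnumP[e] /=.
  have : \forall n \near \oo, limn (f \o z_) - f (z_ n) < k * e%:num.
    have /cvgrPdist_lt/(_ (k * e%:num)) := fz_cvg.
    rewrite mulr_gt0// => /(_ isT); apply: filterS => n.
    by apply: le_lt_trans; exact: ler_norm.
  move=> [N _ HN]; exists (z_ N); exists N => // m /= Nm.
  rewrite -ball_normE/= distrC -(ltr_pM2l k0).
  have [_ /le_lt_trans] := Sz _ _ Nm; apply.
  by apply: le_lt_trans (HN N (leqnn _)); rewrite lerB.
pose z := limn z_.
have zz : z_ @ \oo --> z by [].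
have fzz : f \o z_ @ \oo --> f z by apply: cvg_comp zz _; exact: cf.
have Az' : A z.
  by apply: (closed_cvg _ cA) zz; exact: nearW.
have SzL n : S (z_ n) z.
  split=> //; apply: (@ler_cvg_to _ \oo _ _ (fun m => k * `|z_ m - z_ n|)
      (fun m => f (z_ m) - f (z_ n))).
  - apply: cvgMr; apply: cvg_norm; apply: cvgB => //; exact: cvg_cst.
  - by apply: cvgB => //; exact: cvg_cst.
  - by exists n => // m /= nm; have [] := Sz _ _ nm.
exists z; split=> //; first by have [] := SzL 0.
move=> u Au; rewrite leNgt; apply/negP => fuz.
have Szu : S z u by split=> //; rewrite lerBrDl ltW.
suff : f u <= f z.
  by move=> h; have := lt_le_trans fuz h; rewrite gtrDl pmulr_rlt0// ltNge normr_ge0.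
(* [u] lies in every [S (z_ n)], so the half-gain rule applies to it; the increment on the right
   tends to 0. *)
have fu n : f u <= f (z_ n.+1) + (f (z_ n.+1) - f (z_ n)).
  have [_] := nextP _ (Az n); rewrite -/(z_ n.+1) => h.
  rewrite (le_trans _ (_ : sup (f @` S (z_ n)) <= _))//.
    by apply: ub_le_sup => //; exists u => //; exact: Strans (SzL n) Szu.
  by rewrite -lerBlDl.
have fzS : (fun n => f (z_ n.+1)) @ \oo --> f z by rewrite (cvg_shiftS (f \o z_)).
rewrite -[leRHS]addr0 -(subrr (f z)).
apply: (@ler_cvg_to _ \oo _ _ (fun=> f u)
   (fun n => f (z_ n.+1) + (f (z_ n.+1) - f (z_ n)))).
- exact: cvg_cst.
- by apply: cvgD => //; apply: cvgB.
- exact: nearW.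
Qed.

(** * Hahn-Banach theorem for sublinear functionals *)

Definition sublinear (R : realType) (X : lmodType R) (p : X -> R) :=
  (forall x y, p (x + y) <= p x + p y) /\
  (forall t x, 0 <= t -> p (t *: x) = t * p x).

Section sublinear_theory.
Variables (R : realType) (X : lmodType R).
Implicit Types (p q : X -> R) (x y : X).

Lemma sublinear0 p : sublinear p -> p 0 = 0.
Proof. by move=> [_ /(_ 0 0 (lexx _))]; rewrite scale0r mul0r. Qed.

Lemma sublinearN p x : sublinear p -> - p (- x) <= p x.
Proof.
by move=> sp; have := sp.1 x (- x); rewrite subrr sublinear0// => h; lra.
Qed.

(** Applying the inequality to [t^-1] gives the reverse one. Functionals defined as infima are
    checked this way. *)
Lemma sublinear_le p : p 0 = 0 -> (forall x y, p (x + y) <= p x + p y) ->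
  (forall t x, 0 < t -> p (t *: x) <= t * p x) -> sublinear p.
Proof.
move=> p0 pD pZ; split=> // t x; rewrite le_eqVlt => /predU1P[<-|t0].
  by rewrite scale0r mul0r p0.
apply/eqP; rewrite eq_le pZ//= -ler_pdivlMl//.
have := pZ t^-1 (t *: x); rewrite invr_gt0 => /(_ t0).
by rewrite scalerA mulVf ?gt_eqF// scale1r.
Qed.

(* The witness is the infimal convolution
   [q x = inf_(c in K) p (x + c.1) - c.2]. *)
Lemma sublinear_below_cone p (K : set (X * R)) : sublinear p ->
  K (0, 0) ->
  (forall c d, K c -> K d -> K (c.1 + d.1, c.2 + d.2)) ->
  (forall t c, 0 < t -> K c -> K (t *: c.1, t * c.2)) ->
  (forall c, K c -> c.2 <= p c.1) ->
  exists q, [/\ sublinear q, forall x, q x <= p x &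
    forall c, K c -> q (- c.1) <= - c.2].
Proof.
move=> sp K0 KD KZ Kp; have [pD pZ] := sp.
pose V x := [set p (x + c.1) - c.2 | c in K].
(* This lower bound makes the infimum genuine: subadditivity gives [p c.1 <= p (x + c.1) + p (- x)],
   and [c.2 <= p c.1] on [K]. *)
have lbV x : lbound (V x) (- p (- x)).
  move=> _ [c Kc <-]; have := pD (x + c.1) (- x).
  by rewrite addrAC subrr add0r; have := Kp _ Kc; lra.
pose q x := inf (V x).
have q_lb x c : K c -> q x <= p (x + c.1) - c.2.
  by move=> Kc; apply: ge_inf; [exists (- p (- x)) | exists c].
have q_glb x m : (forall c, K c -> m <= p (x + c.1) - c.2) -> m <= q x.
  move=> h; apply: lb_le_inf; first by exists (p (x + 0) - 0), (0, 0).
  by move=> _ [c Kc <-]; exact: h.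
have qp x : q x <= p x by have := q_lb x _ K0; rewrite addr0 subr0.
exists q; split=> //; last first.
  by move=> c Kc; have := q_lb (- c.1) _ Kc; rewrite addNr sublinear0// sub0r.
apply: sublinear_le.
- apply/eqP; rewrite eq_le; apply/andP; split.
    by rewrite (le_trans (qp 0))// sublinear0.
  by apply: q_glb => c Kc; rewrite add0r subr_ge0 Kp.
- move=> x y; rewrite -lerBlDr; apply: (q_glb x) => c Kc.
  rewrite lerBlDr -lerBlDl; apply: (q_glb y) => d Kd.
  have := q_lb (x + y) _ (KD _ _ Kc Kd); rewrite /= addrACA.
  by have := pD (x + c.1) (y + d.1); lra.
- move=> t x t0; rewrite -ler_pdivrMl//; apply: q_glb => c Kc.
  rewrite ler_pdivrMl//; have := q_lb (t *: x) _ (KZ _ _ t0 Kc).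
  by rewrite /= -scalerDr pZ ?(ltW t0)// mulrBr.
Qed.

(** Zorn's lemma, with smaller functionals placed higher. A nonempty chain is bounded by its
    pointwise infimum, which is finite because [- p (- x)] lies below every member. *)
Lemma sublinear_minimal p : sublinear p -> exists q,
  [/\ sublinear q, forall x, q x <= p x &
    forall q', sublinear q' -> (forall x, q' x <= q x) ->
      forall x, q x <= q' x].
Proof.
move=> sp.
pose T := {q | sublinear q /\ forall x, q x <= p x}.
pose rel (s t : T) := `[< forall x, sval t x <= sval s x >].
have refl t : rel t t by apply/asboolP.
have trans r s t : rel r s -> rel s t -> rel r t.
  move=> /asboolP rs /asboolP st; apply/asboolP => x.
  exact: le_trans (st x) (rs x).
have t0 : T by exists p; split.
have [|q qmin] := @ZL_preorder T t0 rel refl trans.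
  move=> A Atot.
  have [[a Aa]|A0] := pselect (A !=set0); last first.
    by exists t0 => s As; exfalso; apply: A0; exists s.
  pose V x := [set sval s x | s in A].
  have lbV x : lbound (V x) (- p (- x)).
    move=> _ [s _ <-]; have [ss sp'] := svalP s.
    by rewrite (le_trans _ (sublinearN x ss))// lerN2.
  pose q x := inf (V x).
  have q_lb x s : A s -> q x <= sval s x.
    by move=> As; apply: ge_inf; [exists (- p (- x)) | exists s].
  have q_glb x m : (forall s, A s -> m <= sval s x) -> m <= q x.
    move=> h; apply: lb_le_inf; first by exists (sval a x), a.
    by move=> _ [s As <-]; exact: h.
  have qp x : q x <= p x.
    by rewrite (le_trans (q_lb x _ Aa))//; have [_] := svalP a.
  have sq : sublinear q.
    apply: sublinear_le.
    - apply/eqP; rewrite eq_le; apply/andP; split.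
        by rewrite (le_trans (qp 0))// sublinear0.
      by apply: q_glb => s _; have [/sublinear0 ->] := svalP s.
    - move=> x y; rewrite -lerBlDr; apply: (q_glb x) => s As.
      rewrite lerBlDr -lerBlDl; apply: (q_glb y) => r Ar; rewrite lerBlDl.
      (* Subadditivity of the infimum uses the chain: the smaller of [r] and [s] serves for both [x]
         and [y]. *)
      have [/asboolP rs|/asboolP sr] := Atot _ _ As Ar.
        rewrite (le_trans (q_lb _ _ Ar))//; have [[rD _] _] := svalP r.
        by rewrite (le_trans (rD x y))// lerD2r.
      rewrite (le_trans (q_lb _ _ As))//; have [[sD _] _] := svalP s.
      by rewrite (le_trans (sD x y))// lerD2l.
    - move=> t x t_gt0; rewrite -ler_pdivrMl//; apply: q_glb => s As.
      rewrite ler_pdivrMl//; have [[_ sZ] _] := svalP s.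
      by rewrite -sZ ?(ltW t_gt0)//; exact: q_lb.
  exists (exist _ q (conj sq qp)) => s As; apply/asboolP => x /=.
  exact: q_lb.
have [sq qp] := svalP q; exists (sval q); split=> // q' sq' q'q x.
have q'p y : q' y <= p y := le_trans (q'q y) (qp y).
pose t : T := exist _ q' (conj sq' q'p).
have /asboolP := qmin t (asboolT q'q); exact.
Qed.

Lemma linear_of_fun (Y : lmodType R) (f : X -> Y) : linear f ->
  exists F : {linear X -> Y}, F =1 f.
Proof.
move=> lf.
pose F : {linear X -> Y} := HB.pack f (GRing.isLinear.Build _ _ _ _ _ lf).
by exists F.
Qed.

(* Taking for [K] the ray through [(y, q y)] in [sublinear_below_cone] shows
   that a minimal sublinear [q] is odd, hence linear. *)
Theorem sublinear_hahn_banach p : sublinear p ->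
  exists h : {linear X -> R^o}, forall x, h x <= p x.
Proof.
move=> /sublinear_minimal[q [sq qp qmin]].
have [qD qZ] := sq.
have qN y : q (- y) = - q y.
  have K y0 : exists q', [/\ sublinear q', forall x, q' x <= q x &
      q' (- y0) <= - q y0].
    have [|||||q' [sq' q'q q'K]] := @sublinear_below_cone q
      [set c | exists2 t, 0 <= t & c = (t *: y0, t * q y0)].
    - by [].
    - by exists 0 => //; rewrite scale0r mul0r.
    - move=> _ _ [t t0 ->] [s s0 ->]; exists (t + s); first exact: addr_ge0.
      by rewrite /= scalerDl mulrDl.
    - move=> t _ t0 [s s0 ->]; exists (t * s); first by rewrite mulr_ge0// ltW.
      by rewrite /= scalerA mulrA.
    - by move=> _ [t t0 ->] /=; rewrite qZ.
    exists q'; split=> //.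
    by have /= := q'K (y0, q y0); apply; exists 1; rewrite ?scale1r ?mul1r.
  have [q' [sq' q'q q'y]] := K y.
  apply/eqP; rewrite eq_le (le_trans (qmin _ sq' q'q _) q'y)/=.
  by have := sublinearN (- y) sq; rewrite opprK.
have qadd x y : q (x + y) = q x + q y.
  apply/eqP; rewrite eq_le qD/=.
  by have := qD (x + y) (- y); rewrite addrK qN lerBrDr.
have lq : linear (q : X -> R^o).
  move=> t x y; rewrite qadd; congr (_ + _).
  have [t0|t0] := leP 0 t; first exact: qZ.
  by rewrite -[t]opprK scaleNr qN qZ ?oppr_ge0 ?ltW// -mulNr.
have [h hq] := linear_of_fun lq.
by exists h => x; rewrite hq.
Qed.

(** A linear [h] below the [q] of [sublinear_below_cone] satisfies [h (- c.1) <= - c.2], which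
    oddness reverses. This separates the cone of lower constraints [K] from [p]. *)
Corollary sublinear_sandwich p (K : set (X * R)) : sublinear p ->
  K (0, 0) ->
  (forall c d, K c -> K d -> K (c.1 + d.1, c.2 + d.2)) ->
  (forall t c, 0 < t -> K c -> K (t *: c.1, t * c.2)) ->
  (forall c, K c -> c.2 <= p c.1) ->
  exists2 h : {linear X -> R^o}, forall x, h x <= p x &
    forall c, K c -> c.2 <= h c.1.
Proof.
move=> sp K0 KD KZ Kp.
have [q [/sublinear_hahn_banach[h hq] qp qK]] :=
  sublinear_below_cone sp K0 KD KZ Kp.
exists h => [x|c Kc]; first exact: le_trans (hq x) (qp x).
by have := le_trans (hq (- c.1)) (qK _ Kc); rewrite linearN lerN2.
Qed.

End sublinear_theory.

(** * Bishop-Phelps-Bollobás for functionals *)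

Lemma unit_ball_closed (R : realType) (X : normedModType R) :
  closed [set x : X | `|x| <= 1].
Proof.
by apply: (preimage_closed _ (@closed_le _ 1)) => x _; exact: norm_continuous.
Qed.

Lemma ball_bounded_continuous (R : realType) (X Y : normedModType R)
  (f : {linear X -> Y}) : ball_bounded f -> continuous f.
Proof.
move=> bf; apply: bounded_linear_continuous; apply/linear_boundedP.
exists (opnorm f); split; rewrite ?num_real// => r fr x.
by rewrite (le_trans (opnorm_linear x bf))// ler_wpM2r// ltW.
Qed.

(** Ekeland's [z] makes [f] at most [k] times the norm on directions pointing from [z] into the
    ball. The sandwich theorem puts a linear [h] between them, so [f - h] is maximal on the ball at
    [z]. *)
Lemma bishop_phelps (R : realType) (X : completeNormedModType R)
    (f : {linear X -> R^o}) (k : R) (x : X) :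
  ball_bounded f -> `|x| <= 1 -> 0 < k ->
  exists (z : X) (h : {linear X -> R^o}),
    [/\ `|z| <= 1, k * `|z - x| <= f z - f x, forall u, `|h u| <= k * `|u| &
      forall u, `|u| <= 1 -> f u - h u <= f z - h z].
Proof.
move=> bf x1 k0.
have [|z [z1 zx zmax]] := ekeland (@unit_ball_closed R X)
  (ball_bounded_continuous bf) _ k0 x1.
  exists (opnorm f) => _ [u u1 <-].
  by rewrite (le_trans (ler_norm _))// opnorm_ub.
(* The graph of [f] over the cone generated by the unit ball translated by [- z]: for [t > 0] the
   condition says [c.1 = t (u - z)] with [u] in the ball. *)
pose K : set (X * R) :=
  [set c | c.2 = f c.1 /\ exists2 t, 0 <= t & `|c.1 + t *: z| <= t].
have [|||||h hk hK] := @sublinear_sandwich R X (fun v => k * `|v|) K.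
- split=> [u v|t u t0]; first by rewrite -mulrDr ler_pM2l// ler_normD.
  by rewrite normrZ ger0_norm// mulrCA.
- split; first by rewrite /= linear0.
  by exists 0 => //=; rewrite scale0r addr0 normr0.
- move=> c d [c2 [t t0 ct]] [d2 [s s0 ds]]; split.
    by rewrite /= linearD c2 d2.
  exists (t + s); first exact: addr_ge0.
  rewrite /= scalerDl addrACA (le_trans (ler_normD _ _))//; exact: lerD.
- move=> t c t0 [c2 [s s0 cs]]; split; first by rewrite /= linearZ c2.
  exists (t * s); first by rewrite mulr_ge0// ltW.
  by rewrite /= -scalerA -scalerDr normrZ gtr0_norm// ler_pM2l.
- move=> c [-> [t t0 ct]].
  move: t0; rewrite le_eqVlt => /predU1P[t0|t0].
    move: ct; rewrite -t0 scale0r addr0 normr_le0 => /eqP ->.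
    by rewrite linear0 normr0 mulr0.
  have u1 : `|t^-1 *: c.1 + z| <= 1.
    rewrite -(ler_pM2l t0) mulr1 -[X in X * _]gtr0_norm// -normrZ scalerDr.
    by rewrite scalerA divff ?gt_eqF// scale1r.
  have := zmax _ u1; rewrite linearD linearZ/= addrK addrC lerD2l.
  by rewrite normrZ gtr0_norm ?invr_gt0// mulrCA ler_pM2l ?invr_gt0.
exists z, h; split=> // u.
  rewrite ler_norml hk andbT; have := hk (- u).
  by rewrite linearN normrN; rewrite lerNl.
move=> u1; have Ku : K (u - z, f (u - z)).
  by split=> //; exists 1; rewrite //= scale1r subrK.
by have /= := hK _ Ku; rewrite !linearB/= => h1; lra.
Qed.

Lemma bishop_phelps_bollobas_nonsquare (R : realType)
    (X : completeNormedModType R) (f : {linear X -> R^o}) (k a : R) (x : X) :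
  ball_bounded f -> opnorm f = 1 -> `|x| = 1 -> 0 < k <= 2^-1 ->
  0 <= a <= nonsquareness X ->
  exists (z : X) (g : {linear X -> R^o}),
    [/\ `|z| = 1, k * `|z - x| <= 1 - f x, ball_bounded g /\ opnorm g = 1,
      g z = 1 & opnorm (fun u => f u - g u) <= 2 * k * (1 - 3^-1 * a)].
Proof.
move=> bf f1 x1 /andP[k0 k2] /andP[a0 aX].
have a1 : a <= 1 by rewrite (le_trans aX)// (nonsquareness_le1 x1).
have [|z [h [z1 zx hk vmax]]] := bishop_phelps bf _ k0 (x := x); first by rewrite x1.
have bh : ball_bounded h.
  by exists k => u u1; rewrite (le_trans (hk u))// ler_piMr// ltW.
have hk1 : opnorm h <= k.
  by apply: opnorm_le => u u1; rewrite (le_trans (hk u))// ler_piMr// ltW.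
have [v vE] : exists v : {linear X -> R^o}, v =1 (fun u => f u - h u).
  by exists (f \- h).
have bv : ball_bounded v.
  have [M fM] := bf; exists (M + k) => u u1; rewrite vE.
  rewrite (le_trans (ler_normB _ _))// lerD ?fM//.
  by rewrite (le_trans (hk u))// ler_piMr// ltW.
have bfv s t : ball_bounded (fun u => s *: f u + t *: v u : R^o).
  by apply: ball_boundedD; exact: ball_boundedZ.
pose n s t := opnorm (fun u => s *: f u + t *: v u : R^o).
have nE (T : X -> R^o) s t : T =1 (fun u => s *: f u + t *: v u) ->
  n s t = opnorm T by move=> /funext ->.
have n10 : n 1 0 = 1.
  by rewrite (nE f) // => u; rewrite scale1r scale0r addr0.
(* The ball is symmetric, so the maximum of [v] at [z] is its norm. *)
have n01 : n 0 1 = v z.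
  rewrite (nE v); last by move=> u /=; rewrite scale1r scale0r add0r.
  apply/eqP; rewrite eq_le; apply/andP; split.
    apply: opnorm_le => u u1; rewrite ler_norml lerNl -linearN !vE.
    by rewrite !vmax ?normrN.
  by rewrite (le_trans (ler_norm _))// opnorm_ub.
have n1N : n 1 (-1) <= k.
  rewrite (nE h)// => u /=; rewrite vE scale1r scaleN1r.
  by rewrite opprB addrC subrK.
have nD s t s' t' : n (s + s') (t + t') <= n s t + n s' t'.
  apply: le_trans (opnormD (bfv s t) (bfv s' t')).
  by rewrite -(nE _ (s + s') (t + t'))// => u; rewrite !scalerDl addrACA.
have nZ r s t : n (r * s) (r * t) = `|r| * n s t.
  rewrite -opnormZ//; apply: nE => u.
  by rewrite scalerDr !scalerA.
have nsq s t s' t' : n s t <= 1 -> n s' t' <= 1 ->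
    n (s + s') (t + t') + n (s - s') (t - t') <= 4 - 2 * a.
  pose F p q : {linear X -> R^o} := (p \*: f) \+ (q \*: v).
  move=> st st'; have := @dual_nonsquareness R X (F s t) (F s' t').
  move=> /(_ (bfv s t) (bfv s' t') st st').
  rewrite -(nE _ (s + s') (t + t')); last first.
    by move=> u /=; rewrite !scalerDl addrACA.
  rewrite -(nE _ (s - s') (t - t')); first by move=> h1; lra.
  by move=> u /=; rewrite !scalerBl opprD addrACA.
(* From [1 = opnorm f <= k + v z] and [k <= 2^-1]. *)
have v0 : 0 < v z.
  have := nD 1 (-1) 0 1; rewrite addr0 addNr n10 n01 => h1; lra.
(* [v z] is the norm of [v] and is positive, so [z] cannot be interior to the ball. *)
have z1' : `|z| = 1.
  apply/eqP; rewrite eq_le z1/=.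
  have := opnorm_linear z bv.
  rewrite -(nE _ 0 1) ?n01; last by move=> u /=; rewrite scale1r scale0r add0r.
  by rewrite gtr0_norm// -[X in X <= _]mulr1 ler_pM2l.
have [g gE] : exists g : {linear X -> R^o}, g =1 (fun u => (v z)^-1 *: v u).
  by exists ((v z)^-1 \*: v).
exists z, g; split=> //.
- apply: le_trans zx _; rewrite lerD2r -f1 (le_trans (ler_norm _))//.
  exact: opnorm_ub.
- rewrite (funext gE); split; first exact: ball_boundedZ.
  rewrite opnormZ// -(nE v 0 1) ?n01; last first.
    by move=> u /=; rewrite scale1r scale0r add0r.
  by rewrite gtr0_norm ?invr_gt0// mulVf ?gt_eqF.
- by rewrite gE -[LHS]/((v z)^-1 * v z) mulVf ?gt_eqF.
- rewrite -(nE _ 1 (- (v z)^-1)); last first.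
    by move=> u /=; rewrite gE scale1r scaleNr.
  by rewrite -n01; apply: seminorm_normalization => //; apply/andP.
Qed.

(* The slack [1 - opnorm f] is charged to [eps]: the normalised functional
   exceeds [1 - eps'] at [x] with [eps' * opnorm f = eps - (1 - opnorm f)], and
   [delta <= 2 * (1 - a / 3)] makes the exchange profitable. *)
Lemma bishop_phelps_bollobas_subunit (R : realType)
    (X : completeNormedModType R) (f : {linear X -> R^o}) (eps delta a : R)
    (x : X) :
  ball_bounded f -> opnorm f <= 1 -> `|x| = 1 -> 1 - eps < f x -> eps <= 1 ->
  0 < delta <= 2 * (1 - 3^-1 * a) -> 2 * eps <= delta ->
  0 <= a <= nonsquareness X ->
  exists (z : X) (g : {linear X -> R^o}),
    [/\ `|z| = 1, `|x - z| <= delta, ball_bounded g /\ opnorm g = 1,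
      g z = 1 &
      opnorm (fun u => f u - g u) <= 2 * (1 - 3^-1 * a) * (eps / delta)].
Proof.
move=> bf f1 x1 fx eps1 /andP[d0 dc] epsd aX; set s := opnorm f.
have fxs : f x <= s.
  by rewrite (le_trans (ler_norm _))// opnorm_ub// x1.
have s0 : 0 < s by lra.
have sn : s != 0 by rewrite gt_eqF.
have dn : delta != 0 by rewrite gt_eqF.
(* With [f' = f / s], the quantity [1 - f' x] is less than [k * delta], so the Bishop-Phelps
   estimate puts [z] within [delta] of [x]. *)
pose k := (eps - (1 - s)) / (s * delta).
have ksd : k * (s * delta) = eps - (1 - s).
  by rewrite /k divfK// mulf_neq0.
have k0 : 0 < k by rewrite divr_gt0 ?mulr_gt0//; lra.
have k2 : k <= 2^-1.
  rewrite ler_pdivrMr ?mulr_gt0// -ler_pdivrMl ?invr_gt0// invrK mulrC.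
  have := ler_wpM2l (ltW s0) epsd.
  have := mulr_ge0 (_ : 0 <= 1 - s) (_ : 0 <= 1 - eps).
  rewrite !subr_ge0 => /(_ f1 eps1); lra.
have [f' f'E] : exists f' : {linear X -> R^o}, f' =1 (fun u => s^-1 *: f u).
  by exists (s^-1 \*: f).
have bf' : ball_bounded f' by rewrite (funext f'E); exact: ball_boundedZ.
have f'1 : opnorm f' = 1.
  by rewrite (funext f'E) opnormZ// gtr0_norm ?invr_gt0// mulVf.
have k02 : 0 < k <= 2^-1 by rewrite k0.
have [z [g [z1 zx [bg g1] gz fg]]] :=
  bishop_phelps_bollobas_nonsquare bf' f'1 x1 k02 aX.
exists z, g; split=> //.
  rewrite distrC -(ler_pM2l k0) (le_trans zx)//.
  rewrite -(ler_pM2l s0) mulrA (mulrC s k) -mulrA ksd f'E.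
  by rewrite -[s^-1 *: f x]/(s^-1 * f x) mulrBr mulrA divff// mul1r; lra.
(* The two terms separate the cost of moving [f'] to [g] from that of rescaling. *)
have fgE : (fun u => f u - g u : R^o) =
    (fun u => s *: (f' u - g u) + (s - 1) *: g u).
  apply/funext => u; rewrite f'E scalerBr scalerA divff// scale1r.
  by rewrite scalerBl scale1r addrA subrK.
have bfg : ball_bounded (fun u => f' u - g u).
  have [M fM] := bf'; have [N gN] := bg; exists (M + N) => u u1.
  by rewrite (le_trans (ler_normB _ _))// lerD ?fM ?gN.
rewrite fgE (le_trans (opnormD _ _))//; [exact: ball_boundedZ..|].
rewrite !opnormZ// gtr0_norm// g1 mulr1 distrC ger0_norm ?subr_ge0//.
have := ler_wpM2l (ltW s0) fg => h.
apply: le_trans (lerD h (lexx _)) _.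
rewrite [leRHS]mulrA ler_pdivlMr//.
have -> : (s * (2 * k * (1 - 3^-1 * a)) + (1 - s)) * delta =
  2 * (1 - 3^-1 * a) * (k * (s * delta)) + (1 - s) * delta by ring.
rewrite ksd.
by have := ler_wpM2l (_ : 0 <= 1 - s) dc; rewrite subr_ge0 => /(_ f1); lra.
Qed.

(** * From functionals to operators: property beta and the modulus *)

(** Adding a multiple of [y b] makes [ys b] see [(1 + eta) g], which reaches [1 + eta] at [z], while
    every other [ys c] sees the added term damped by [rho]. *)
Lemma beta_perturbation (R : realType) (X Y : normedModType R)
    (rho : R) (Lambda : Type) (y : Lambda -> Y) (ys : Lambda -> {linear Y -> R^o})
    (T : {linear X -> Y}) (b : Lambda) (z : X) (g : {linear X -> R^o}) :
  0 <= rho < 1 ->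
  (forall c, unit_sphere (y c) /\ operator_sphere (ys c)) ->
  (forall c, ys c (y c) = 1) ->
  (forall c d, c <> d -> `|ys c (y d)| <= rho) ->
  (forall v, `|v| = sup [set `|ys c v| | c in [set: Lambda]]) ->
  operator_sphere T -> `|z| = 1 -> ball_bounded g -> opnorm g = 1 -> g z = 1 ->
  exists F : {linear X -> Y}, [/\ operator_sphere F, `|F z| = 1 &
    opnorm (T \- F) <=
      opnorm (fun u => ys b (T u) - g u) * ((1 + rho) / (1 - rho))].
Proof.
move=> /andP[rho0 rho1] yS yyb yrho ysup [/bounded_operatorP bT T1] z1 bg g1 gz.
have ysle c v : `|ys c v| <= `|v|.
  have [_ [/bounded_operatorP bys ys1]] := yS c.
  by have := opnorm_linear v bys; rewrite ys1 mul1r.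
have gle u : `|u| <= 1 -> `|g u| <= 1 by move=> u1; rewrite -g1 opnorm_ub.
have Tle u : `|u| <= 1 -> `|T u| <= 1 by move=> u1; rewrite -T1 opnorm_ub.
set kappa := opnorm _.
have bfg : ball_bounded (fun u => ys b (T u) - g u).
  exists 2 => u u1; rewrite (le_trans (ler_normB _ _))//.
  have := gle _ u1; have := Tle _ u1; have := ysle b (T u); lra.
have kappa0 : 0 <= kappa by exact: opnorm_ge0.
have r1 : 0 < 1 - rho by lra.
(* [eta] solves [rho * (eta + kappa) = eta], so the other functionals see at most [1 + eta]. The
   final cost [2 eta + kappa] is then [kappa (1 + rho) / (1 - rho)]. *)
have [eta eta0 etaE] : exists2 eta, 0 <= eta & eta * (1 - rho) = rho * kappa.
  exists (rho * kappa / (1 - rho)); last by rewrite divfK ?gt_eqF.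
  by rewrite divr_ge0 ?mulr_ge0// ltW.
have eta1 : 0 < 1 + eta by lra.
pose w u : R := (1 + eta) * g u - ys b (T u).
have wle u : `|u| <= 1 -> `|w u| <= eta + kappa.
  move=> u1; have -> : w u = eta * g u - (ys b (T u) - g u) by rewrite /w; ring.
  rewrite (le_trans (ler_normB _ _))// lerD//; last exact: (opnorm_ub bfg).
  by rewrite normrM ger0_norm// ler_piMr// gle.
have [S SE] : exists S : {linear X -> Y}, S =1 (fun u => T u + w u *: y b).
  apply: linear_of_fun => t u v.
  have -> : w (t *: u + v) = t * w u + w v.
    have gE : g (t *: u + v) = t * g u + g v := linearP g t u v.
    have yE : ys b (t *: T u + T v) = t * ys b (T u) + ys b (T v) :=
      linearP (ys b) t (T u) (T v).
    by rewrite /w gE linearP yE; ring.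
  by rewrite linearP scalerDl scalerDr scalerA addrACA.
have ysS c u : ys c (S u) = ys c (T u) + w u * ys c (y b).
  by rewrite SE linearD linearZ.
have ysSb u : ys b (S u) = (1 + eta) * g u.
  by rewrite ysS yyb /w mulr1 [LHS]addrC subrK.
have Sle u : `|u| <= 1 -> `|S u| <= 1 + eta.
  move=> u1; rewrite ysup; apply: ge_sup; first by exists `|ys b (S u)|, b.
  move=> _ [c _ <-]; have [->|cb] := pselect (c = b).
    rewrite ysSb normrM gtr0_norm//.
    by rewrite ler_piMr ?gle// ltW.
  rewrite ysS (le_trans (ler_normD _ _))// lerD//.
    by rewrite (le_trans (ysle _ _))// Tle.
  rewrite normrM (le_trans (ler_pM _ _ (wle _ u1) (yrho _ _ cb)))//.
  by move: etaE; lra.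
have Sz : `|S z| = 1 + eta.
  apply/eqP; rewrite eq_le Sle ?z1//= (le_trans _ (ysle b _))//.
  by rewrite ysSb gz mulr1 ler_norm.
have [F FE] : exists F : {linear X -> Y}, F =1 (fun u => (1 + eta)^-1 *: S u).
  by exists ((1 + eta)^-1 \*: S).
have Fle u : `|u| <= 1 -> `|F u| <= 1.
  move=> u1; rewrite FE normrZ gtr0_norm ?invr_gt0// ler_pdivrMl// mulr1.
  exact: Sle.
have bF : ball_bounded F by exists 1.
have Fz : `|F z| = 1.
  by rewrite FE normrZ gtr0_norm ?invr_gt0// Sz mulVf ?gt_eqF.
exists F; split=> //.
  split; first exact/bounded_operatorP.
  apply/eqP; rewrite eq_le opnorm_le//= -Fz.
  by apply: opnorm_ub; rewrite ?z1.
apply: opnorm_le => u u1.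
have -> : (T \- F) u = eta *: F u - w u *: y b.
  rewrite /= -[T u](addrK (w u *: y b)) -SE.
  have -> : S u = (1 + eta) *: F u by rewrite FE scalerA divff ?gt_eqF// scale1r.
  by rewrite scalerDl scale1r addrAC [F u + _]addrC addrK.
rewrite (le_trans (ler_normB _ _))// !normrZ (ger0_norm eta0).
have [-> _] := yS b; rewrite mulr1.
apply: le_trans (_ : eta + (eta + kappa) <= _).
  by rewrite lerD ?wle// ler_piMr// Fle.
by rewrite mulrA ler_pdivlMr//; move: etaE; lra.
Qed.

(** [delta] stays free because two values are used later: the target distance, and
    [2 * (1 - alpha0 / 3)] at an auxiliary point. *)
Lemma beta_bishop_phelps_bollobas (R : realType) (X Y : completeNormedModType R)
    (rho a eps delta : R) (x : X) (T : {linear X -> Y}) :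
  property_beta Y rho -> operator_sphere T -> `|x| = 1 -> 1 - eps < `|T x| ->
  eps <= 1 -> 0 < delta <= 2 * (1 - 3^-1 * a) -> 2 * eps <= delta ->
  0 <= a <= nonsquareness X ->
  exists (z : X) (F : {linear X -> Y}),
    [/\ `|z| = 1, operator_sphere F, `|F z| = 1, `|x - z| <= delta &
      opnorm (T \- F) <=
        2 * (1 - 3^-1 * a) * (eps / delta) * ((1 + rho) / (1 - rho))].
Proof.
move=> [hrho [Lambda [y [ys [yS yy yrho ysup]]]]] TS x1 Tx eps1 hd epsd aX.
have [/bounded_operatorP bT T1] := TS.
have [b bx] : exists b, 1 - eps < `|ys b (T x)|.
  move: Tx; rewrite ysup; have [[b _]|L0] := pselect ([set: Lambda] !=set0).
    by move=> /sup_gt[|_ [c _ <-] ?]; [exists `|ys b (T x)|, b|exists c].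
  (* For an empty index type the norm is the default supremum 0, contradicting [1 - eps < 0] since
     [eps <= 1]. *)
  have -> : [set: Lambda] = set0.
    by apply/seteqP; split=> // c _; apply: L0; exists c.
  by rewrite image_set0 sup0 => h; lra.
wlog fx : x x1 Tx bx / 1 - eps < ys b (T x).
  move=> wl; have [|nfx] := leP 0 (ys b (T x)) => [fx|].
    by apply: (wl x) => //; move: bx; rewrite ger0_norm.
  have [||||z [F [z1 FS Fz zx TF]]] := wl (- x); rewrite ?normrN//.
  - by rewrite linearN normrN.
  - by rewrite !linearN normrN.
  - by move: bx; rewrite !linearN ltr0_norm.
  exists (- z), F; split; rewrite ?normrN// ?linearN ?normrN//.
  by rewrite opprK -normrN opprD.
have [f fE] : exists f : {linear X -> R^o}, f =1 (fun u => ys b (T u)).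
  by exists (ys b \o T).
have [_ [/bounded_operatorP bys ys1]] := yS b.
have fle u : `|u| <= 1 -> `|f u| <= 1.
  move=> u1; rewrite fE (le_trans (opnorm_linear _ bys))// ys1 mul1r -T1.
  exact: opnorm_ub.
have bf : ball_bounded f by exists 1.
have [||z [g [z1 xz [bg g1] gz fg]]] :=
  @bishop_phelps_bollobas_subunit R X f eps delta a x bf _ x1 _ eps1 hd epsd aX.
- exact: opnorm_le.
- by rewrite fE.
have [F [FS Fz TF]] :=
  beta_perturbation b hrho yS yy yrho ysup TS z1 bg g1 gz.
exists z, F; split=> //; apply: le_trans TF _.
rewrite ler_wpM2r//; first by rewrite divr_ge0//; lra.
by move: fg; congr (opnorm _ <= _); apply/funext => u; rewrite fE.
Qed.

Theorem theorem2p6 (R : realType) (X Y : completeNormedModType R)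
    (rho alpha0 : R) (hrho : 0 <= rho < 1) (hY : property_beta Y rho)
    (hX : uniformly_nonsquare X) (halpha0 : 0 < alpha0 < nonsquareness X) :
  let eps0 := Num.min
    (2 / (1 - 3^-1 * alpha0) * ((1 - rho) / (1 + rho)))
    (2^-1 * ((1 + rho) / (1 - rho)) * (1 - 3^-1 * alpha0)) in
  forall eps : R, 0 < eps < eps0 ->
  (spherical_BPB_modulus X Y eps <=
    (Num.sqrt (2 * eps * (1 - 3^-1 * alpha0)) *
     Num.sqrt ((1 + rho) / (1 - rho)))%:E)%E.
Proof.
move=> eps0 eps /andP[e0]; rewrite lt_min => /andP[].
rewrite -[(1 - rho) / (1 + rho)]invf_div.
have q0 : 0 < (1 + rho) / (1 - rho) by case/andP: hrho => ? ?; rewrite divr_gt0; lra.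
set q := (1 + rho) / (1 - rho) in q0 *; set c := 1 - 3^-1 * alpha0.
set delta := Num.sqrt _ * _ => e1 e2.
(* The modulus asks for strict inequalities, whereas the construction gives [<= delta]; an arbitrary
   slack [d] bridges the gap. *)
apply/lee_addgt0Pr => _/posnumP[d]; apply: ereal_inf_lbound.
exists (delta + d%:num) => //=.
have delta_ge0 : 0 <= delta by rewrite mulr_ge0 ?sqrtr_ge0.
split; first by rewrite ltr_wpDl.
move=> x T x1 TS Tx.
have {}halpha0 : 0 <= alpha0 <= nonsquareness X by case/andP: halpha0 => *; lra.
have [a0 aX] := andP halpha0.
have a1 := le_trans aX (nonsquareness_le1 x1).
have c0 : 0 < c by rewrite /c; lra.
have delta2 : delta * delta = 2 * eps * c * q.
  rewrite /delta mulrACA -!expr2 !sqr_sqrtr ?(ltW q0)//.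
  by rewrite !mulr_ge0// ltW.
have delta0 : 0 < delta.
  by rewrite mulr_gt0// sqrtr_gt0// !mulr_gt0.
have e1' : eps * (c * q) < 2.
  by move: e1; rewrite -mulrA -invfM ltr_pdivlMr// mulr_gt0.
(* If [eps > 1], the second bound gives [c * q > 2 * eps > 2], against [eps * (c * q) < 2]. *)
have eps1 : eps <= 1.
  have cq0 := mulr_gt0 c0 q0; rewrite leNgt; apply/negP => eps1.
  have := mulr_gt0 cq0 (_ : 0 < eps - 1); rewrite subr_gt0 => /(_ eps1); lra.
suff [z [F [z1 FS Fz xz TF]]] : exists (z : X) (F : {linear X -> Y}),
    [/\ `|z| = 1, operator_sphere F, `|F z| = 1, `|x - z| <= delta &
      opnorm (T \- F) <= delta].
  exists z, F; split=> //; first by rewrite (le_lt_trans xz)// ltrDl.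
  by rewrite (le_lt_trans TF)// ltrDl.
have [dc|dc] := leP delta (2 * c).
  have [||z [F [z1 FS Fz xz TF]]] := @beta_bishop_phelps_bollobas R X Y rho
      alpha0 eps delta x T hY TS x1 Tx eps1 _ _ halpha0.
  - by rewrite delta0.
  (* [eps < c * q / 2] gives [delta * delta = 2 * eps * c * q > 4 * eps * eps]. *)
  - rewrite leNgt; apply/negP => h.
    have := ltr_pM delta_ge0 delta_ge0 h h; rewrite delta2.
    have := mulr_gt0 e0 (_ : 0 < 2^-1 * q * c - eps).
    by rewrite subr_gt0 => /(_ e2); lra.
  exists z, F; split=> //; apply: le_trans TF _.
  rewrite -/c -/q -(ler_pM2r delta0) delta2.
  have -> : 2 * c * (eps / delta) * q * delta = 2 * eps * c * q.
    by field; rewrite gt_eqF.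
  by [].
(* A point [x'] where [T] nearly attains its norm replaces [x]; after a
   change of sign non-squareness puts any [z] within [3 c - 1 <= 2 c] of [x]. *)
have e'eps : 2 * c / q < eps.
  rewrite ltr_pdivrMr// -(ltr_pM2l (mulr_gt0 (ltr0n _ 2 : 0 < 2) c0)).
  have : 2 * c * (2 * c) < delta * delta by apply: ltr_pM => //; rewrite mulr_ge0// ltW.
  by rewrite delta2; lra.
(* The bounds [2 * c / q < eps < q * c / 2] force [q * q > 4]. *)
have q2 : 2 < q.
  have : 2 * c / q < 2^-1 * q * c by exact: lt_trans e'eps e2.
  rewrite ltr_pdivrMr// => h.
  have : 4 < q * q by rewrite -(ltr_pM2l c0); lra.
  by nra.
have [|||x' x'1 Tx'] := @opnorm_sphere_gt _ _ _ T (1 - 2 * c / q).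
- by apply/bounded_operatorP; case: TS.
- lra.
- case: TS => _ ->; rewrite ltrBlDr ltrDl divr_gt0// mulr_gt0//.
(* The tolerance [2 * c / q] at distance [2 * c] yields an operator error of exactly [2 * c], which
   is below [delta]; [q > 2] gives the required [2 * (2 * c / q) <= 2 * c]. *)
have [|||z [F [z1 FS Fz _ TF]]] := @beta_bishop_phelps_bollobas R X Y rho
    alpha0 (2 * c / q) (2 * c) x' T hY TS x'1 Tx' _ _ _ halpha0.
- lra.
- by rewrite lexx mulr_gt0.
- rewrite mulrA ler_pdivrMr//; have := mulr_gt0 c0 q0; nra.
have {}TF : opnorm (T \- F) <= delta.
  apply: le_trans TF (le_trans _ (ltW dc)); rewrite -/c -/q.
  have -> : 2 * c * (2 * c / q / (2 * c)) * q = 2 * c; last by [].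
  by field; rewrite !gt_eqF.
have := nonsquarenessP (_ : `|x| <= 1) (_ : `|z| <= 1).
rewrite x1 z1 => /(_ (lexx _) (lexx _)) xz.
have [xz'|xz'] := leP `|x - z| delta; first by exists z, F.
exists (- z), F; rewrite normrN linearN normrN opprK; split=> //.
by move: dc; rewrite /c => dc; lra.
Qed.
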